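(* For every integer $n\ge 0$, $c_4(n)$ is odd if $n=(7j^2+3j)/2$ for some $j\in\mathbb{Z}$, and $c_4(n)$ is even otherwise.
   Context: A partition of $n\ge 0$ is a finite multiset of positive integers summing to $n$; the empty partition is the partition of $0$. For $n\ge 0$, $c_4(n)$ denotes the number of partitions $\lambda$ of $n$ such that either (a) all parts of $\lambda$ are even and distinct, or (b) there is an integer $j\ge 1$ such that each of $2,4,\dots,2j$ appears in $\lambda$ exactly twice, every even part greater than $2j$ is at least $4j+2$ and appears at most once, and every odd part is at most $2j-1$ and appears at most once. *)

(* Defs.v *)
From mathcomp Require Import all_boot all_order all_algebra.
From mathcomp Require Import boolp.
Set Implicit Arguments. Unset Strict Implicit. Unset Printing Implicit Defensive.

(* A partition of n is encoded by its multiplicity function: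
   f : {ffun 'I_n.+1 -> 'I_n.+1}, where f k is the number of times the part k
   occurs (0 <= k <= n).  Every part of a partition of n is <= n and every
   multiplicity is <= n, and we require that the (meaningless) "part 0" has
   multiplicity 0, so this is a bijection with partitions of n. *)

Definition mult_of (n : nat) (f : {ffun 'I_n.+1 -> 'I_n.+1}) (k : nat) : nat :=
  match @insub nat (fun x => x < n.+1) 'I_n.+1 k with
  | Some i => val (f i)
  | None => 0
  end.

Definition is_partition_of (n : nat) (f : {ffun 'I_n.+1 -> 'I_n.+1}) : Prop :=
  mult_of f 0 = 0 /\ \sum_(k < n.+1) (k * f k) = n.

Definition cond_a (m : nat -> nat) : Prop :=
  forall k, 0 < k -> 0 < m k -> ~~ odd k /\ m k <= 1.

Definition cond_b (m : nat -> nat) : Prop :=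
  exists j : nat, 1 <= j /\
    (forall i, 1 <= i <= j -> m (2 * i) = 2) /\
    (forall k, 0 < k -> ~~ odd k -> 2 * j < k -> 0 < m k ->
         4 * j + 2 <= k /\ m k <= 1) /\
    (forall k, odd k -> 0 < m k -> k <= 2 * j - 1 /\ m k <= 1).

Definition c4 (n : nat) : nat :=
  #|[set f : {ffun 'I_n.+1 -> 'I_n.+1} |
      `[< is_partition_of f /\ (cond_a (mult_of f) \/ cond_b (mult_of f)) >] ]|.

(* Main.v *)
(** Condition (a) is the case [j = 0] of condition (b), and a partition determines
its [j].  Modulo 2, with [Q = q^2], the generating function of [c4] is therefore
[sum_j Q^(j(j+1)) * prod_(i < j) (1 - q^(2i+1)) * prod_(i > 2j) (1 - Q^i)], and this
is summed as in the second Rogers-Selberg identity: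
- the finite identity
  [prod_(i < j) (1 - q^(2i+1)) * (1 - Q^(2j+1))
   = sum_r (-1)^r q^(r(3r-1)/2) [2j+1, j-r]_Q],
  with [r] running over the integers, follows from the Pascal recurrences and the
  symmetries of the sums on the right;
- the Durfee rectangle identity
  [sum_j Q^(j(j+1)) [2j+1, j-r]_Q prod_(i > 2j+1) (1 - Q^i) = Q^(r(r+1))],
  obtained as the limit of a finite identity, then leaves
  [sum_r (-1)^r q^((7r^2+3r)/2)], whose exponents are pairwise distinct. *)

Require Import Defs.
From mathcomp Require Import all_boot all_order all_algebra.
From mathcomp Require Import boolp zify ring.
Set Implicit Arguments. Unset Strict Implicit. Unset Printing Implicit Defensive.
Import GRing.Theory Num.Theory.

(** * Gaussian binomials: Pascal rules, symmetry and row sums *)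

Section GaussianBinomials.
Local Open Scope ring_scope.
Variables (R : comNzRingType) (q : R).

Fixpoint qbin (m k : nat) : R :=
  match m, k with
  | _, 0 => 1
  | 0, _.+1 => 0
  | m'.+1, k'.+1 => qbin m' k' + q ^+ k * qbin m' k
  end.

(* (q^a; q)_(b-a) in Pochhammer notation: the range [a, b) is half-open. *)
Definition qpoch (a b : nat) : R := \prod_(a <= i < b) (1 - q ^+ i).

Lemma qbin0 m : qbin m 0 = 1. Proof. by case: m. Qed.

Lemma qbinS m k : qbin m.+1 k.+1 = qbin m k + q ^+ k.+1 * qbin m k.+1.
Proof. by []. Qed.

Lemma qbin_small m k : (m < k)%N -> qbin m k = 0.
Proof.
elim: m k => [|m IH] [|k] // mk.
by rewrite qbinS !IH ?mulr0 ?addr0 // ltnW.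
Qed.

(** The quotient of neighbouring coefficients, cleared of denominators; Pascal's rule carries it
    from row to row. *)
Lemma qbin_ratio m k : (k <= m)%N ->
  (1 - q ^+ (m - k)) * qbin m k = (1 - q ^+ k.+1) * qbin m k.+1.
Proof.
elim: m k => [|m IH] [|k] // km.
- by rewrite subn0 /= expr0; ring.
- have := IH 0 (leq0n m); rewrite subn0 !qbinS qbin0 expr1 !mulrDr => H.
  have -> : (1 - q) * (q * qbin m 1) = q * ((1 - q) * qbin m 1) by ring.
  rewrite -H exprS mulr1 qbin0 subn0; ring.
- rewrite !qbinS subSS.
  case: (ltnP k m) => [lt_km|mk].
    have -> : (1 - q ^+ k.+2) * (qbin m k.+1 + q ^+ k.+2 * qbin m k.+2)
       = (1 - q ^+ k.+2) * qbin m k.+1 + q ^+ k.+2 * ((1 - q ^+ k.+2) * qbin m k.+2) by ring.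
    rewrite -IH // mulrDr IH 1?ltnW //.
    have -> : (m - k = (m - k.+1).+1)%N by lia.
    rewrite !exprS; ring.
  have -> : k = m by lia.
  by rewrite subnn expr0 subrr mul0r !(@qbin_small m) ?mulr0 ?addr0 ?mulr0 // ltnS leqnSn.
Qed.

(** The two Pascal rules differ by exactly [qbin_ratio]. *)
Lemma qbinS' m k : (k <= m)%N ->
  qbin m.+1 k.+1 = q ^+ (m - k) * qbin m k + qbin m k.+1.
Proof.
move=> /qbin_ratio/eqP; rewrite -subr_eq0 => /eqP H.
by apply/eqP; rewrite -subr_eq0; apply/eqP; rewrite -[RHS]H qbinS; ring.
Qed.

Lemma qbinn m : qbin m m = 1.
Proof. by elim: m => // m IH; rewrite qbinS IH qbin_small // mulr0 addr0. Qed.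

Lemma qbin_sub m k : (k <= m)%N -> qbin m (m - k) = qbin m k.
Proof.
elim: m k => [|m IH] [|k] //; first by rewrite subn0 qbinn.
rewrite subSS ltnS => km; case: (ltnP k m) => [lt_km|mk].
  have -> : (m - k = (m - k.+1).+1)%N by lia.
  rewrite qbinS' ?leq_subr // qbinS IH //.
  have -> : (m - k.+1).+1 = (m - k)%N by lia.
  rewrite IH // subKn //; ring.
have -> : k = m by lia.
by rewrite subnn qbinn.
Qed.

Lemma qbin_qpoch a b :
  qbin (a + b) a * qpoch 1 a.+1 * qpoch 1 b.+1 = qpoch 1 (a + b).+1.
Proof.
elim: a b => [|a IH] b; first by rewrite qbin0 /qpoch big_geq // !mul1r.
have := @qbin_ratio (a.+1 + b) a ltac:(lia).
have -> : (a.+1 + b - a = b.+1)%N by lia.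
rewrite addSnnS -IH /qpoch (big_nat_recr a.+1) //= (big_nat_recr b.+1) //= => H.
by rewrite [_ * (1 - q ^+ a.+1)]mulrC [qbin _ _ * _]mulrA [qbin _ _ * (1 - _)]mulrC -H; ring.
Qed.

(** Pascal's rule transferred to the weights, so that row sums obey recurrences. *)
Lemma sum_qbinS m (f : nat -> R) :
  \sum_(k < m.+2) f k * qbin m.+1 k =
  \sum_(k < m.+1) (f k * q ^+ k + f k.+1) * qbin m k.
Proof.
rewrite big_ord_recl.
under eq_bigr => k _ do rewrite lift0 qbinS mulrDr.
under [RHS]eq_bigr => k _ do rewrite mulrDl.
rewrite !big_split addrCA [RHS]addrC; congr (_ + _).
rewrite [RHS]big_ord_recl big_ord_recr /= (@qbin_small m m.+1) // !mulr0 addr0.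
rewrite !qbin0 expr0 !mulr1; congr (_ + _).
by apply: eq_bigr => k _; rewrite /bump add1n mulrA.
Qed.

Lemma sum_qbin_rev m (f : nat -> R) :
  \sum_(k < m.+1) f k * qbin m k = \sum_(k < m.+1) f (m - k)%N * qbin m k.
Proof.
rewrite (reindex_inj rev_ord_inj); apply: eq_bigr => k _ /=.
by rewrite subSS qbin_sub // -ltnS.
Qed.

(** Reversing the row turns the first Pascal rule into the second. *)
Lemma sum_qbinS' m (f : nat -> R) :
  \sum_(k < m.+2) f k * qbin m.+1 k =
  \sum_(k < m.+1) (f k + q ^+ (m - k) * f k.+1) * qbin m k.
Proof.
rewrite (sum_qbin_rev m.+1 f) (sum_qbinS m (fun k => f (m.+1 - k)%N)).
rewrite (sum_qbin_rev m (fun k => f (m.+1 - k)%N * q ^+ k + f (m.+1 - k.+1)%N)).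
apply: eq_bigr => k _ /=; have km : (k <= m)%N by rewrite -ltnS.
have -> : (m.+1 - (m - k) = k.+1)%N by lia.
have -> : (m.+1 - (m - k).+1 = k)%N by lia.
by rewrite addrC [f _ * _]mulrC.
Qed.

(* By Pascal's rule the sum for (K+1, y) is the sum for (K, y q). *)
Lemma qbin_durfee K (y : R) :
  \sum_(k < K.+1) q ^+ (k * k) * y ^+ k * qbin K k *
     \prod_(k.+1 <= i < K.+1) (1 - y * q ^+ i) = 1.
Proof.
elim: K y => [|K IH] y; first by rewrite big_ord1 big_geq //= !expr0; ring.
under eq_bigr => k _ do rewrite -mulrA [qbin _ _ * _]mulrC mulrA.
rewrite (sum_qbinS _ (fun k => q ^+ (k * k) * y ^+ k *
     \prod_(k.+1 <= i < K.+2) (1 - y * q ^+ i))) -[RHS](IH (y * q)).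
apply: eq_bigr => k _; have kK := ltn_ord k.
rewrite (big_ltn (m := k.+1)) // !big_add1 /=.
under eq_bigr => i _ do rewrite exprS mulrA.
set P := \prod_(_ <= i < _) _.
have -> : (k.+1 * k.+1 = (k * k) + k + k + 1)%N by lia.
rewrite !exprD !expr1 exprMn !exprS; ring.
Qed.

End GaussianBinomials.

Arguments qbin : simpl never.

Lemma rmorph_qbin (R S : comNzRingType) (phi : {rmorphism R -> S}) (q : R) m k :
  phi (qbin q m k) = qbin (phi q) m k.
Proof.
elim: m k => [|m IH] [|k]; rewrite ?qbin0 ?rmorph0 ?rmorph1 //.
by rewrite !qbinS rmorphD rmorphM rmorphXn !IH.
Qed.

(** * Generalized pentagonal numbers *)

Section Pentagonal.
Local Open Scope ring_scope.

Definition pent (r : int) : int := (r * (3 * r - 1) %/ 2)%Z.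

Lemma pentE r : 2 * pent r = r * (3 * r - 1).
Proof.
have dv : (2 %| r * (3 * r - 1))%Z.
  have [d [e|e]] : exists d, r = 2 * d \/ r = 2 * d + 1.
    by exists (r %/ 2)%Z; lia.
  - by rewrite e -mulrA dvdz_mulr.
  - by apply/dvdzP; exists (r * (3 * d + 1)); rewrite {2}e; ring.
by rewrite /pent mulrC divzK.
Qed.

Lemma pentS r : pent (r + 1) = pent r + 3 * r + 1.
Proof. by have := pentE r; have := pentE (r + 1); lia. Qed.

Lemma pentN r : pent (- r) = pent r + r.
Proof. by have := pentE r; have := pentE (- r); lia. Qed.

Definition pentn (r : nat) : nat := 3 * 'C(r, 2) + r.

Lemma pentnS r : pentn r.+1 = (pentn r + 3 * r + 1)%N.
Proof. by rewrite /pentn binS bin1; lia. Qed.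

Lemma pent_nat (r : nat) : pent r = pentn r.
Proof.
elim: r => [|r IH] //; rewrite pentnS; have := pentS r; rewrite IH => H.
by rewrite (_ : r.+1%:Z = r%:Z + 1) ?H; lia.
Qed.

End Pentagonal.

(** * The finite product identity in characteristic 2 *)

Section FiniteIdentity.
Local Open Scope ring_scope.
Variables (K : fieldType) (q : K).
Hypotheses (q0 : q != 0) (K2 : 2 \in [pchar K]).

Local Notation Q := (q ^+ 2).
(* With r = n - k, [A n s] and [B n s] are the sums over all integers r of
   q^(r(3r-1)/2 + s r) times [2n, n-r] and [2n+1, n-r] respectively. *)
Let f (n : nat) (s : int) (k : nat) : K :=
  q ^ (pent (n%:Z - k%:Z) + s * (n%:Z - k%:Z)).
Let S (m : nat) (n : nat) (s : int) : K := \sum_(k < m.+1) f n s k * qbin Q m k.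
Let A (n : nat) (s : int) : K := S n.*2 n s.
Let B (n : nat) (s : int) : K := S n.*2.+1 n s.

Let expn_z (x : K) m : x ^+ m = x ^ m%:Z. Proof. by []. Qed.

Let sum_reflect (m : nat) (g : nat -> K) :
  \sum_(k < m.*2) g k = \sum_(k < m) (g k + g (m.*2.-1 - k)%N).
Proof.
rewrite big_split /= -addnn big_split_ord /=; congr (_ + _).
rewrite (reindex_inj rev_ord_inj); apply: eq_bigr => k _ /=; congr g.
by have := ltn_ord k; lia.
Qed.

(** The reflection r -> -r, by [pentN]. *)
Let Asym n s : A n s = A n (1 - s).
Proof.
rewrite /A /S (sum_qbin_rev _ _ (f n s)); apply: eq_bigr => k _; congr (_ * _).
have kn := ltn_ord k; congr (q ^ _).
rewrite (_ : n%:Z - (n.*2 - k)%N%:Z = - (n%:Z - k%:Z)) ?pentN; last lia.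
set r := (n%:Z - k%:Z); ring.
Qed.

(** Second Pascal rule: the shift r -> r-1 changes the pentagonal number by a linear term, which
    moves [s]. *)
Let BA n s : B n s = A n s + q ^ (n.*2%:Z + 2 - s) * A n (s - 1).
Proof.
rewrite /B /A /S sum_qbinS' mulr_sumr -big_split; apply: eq_bigr => k _ /=.
have kn := ltn_ord k.
rewrite mulrA mulrDl; congr (_ + _ * _).
rewrite -exprM expn_z -!expfzDr //; congr (q ^ _).
have := pentS (n%:Z - k.+1%:Z).
rewrite (_ : n%:Z - k.+1%:Z + 1 = n%:Z - k%:Z) => [->|]; last lia.
rewrite (_ : ((2 * (n.*2 - k))%N%:Z = 2 * (n%:Z - k%:Z) + n.*2%:Z)); last lia.
rewrite (_ : k.+1%:Z = k%:Z + 1); last lia.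
by ring.
Qed.

(* The reflection r -> -1-r pairs equal terms. *)
Let B2 n : B n 2 = 0.
Proof.
rewrite /B /S -doubleS (sum_reflect _ (fun k => f n 2 k * qbin Q n.*2.+1 k)) big1 // => k _.
have kn := ltn_ord k.
rewrite qbin_sub; last lia.
rewrite (_ : f n 2 (n.*2.+1 - k)%N = f n 2 k) ?addrr_pchar2 //.
congr (q ^ _).
rewrite (_ : n%:Z - (n.*2.+1 - k)%N%:Z = - (n%:Z - k%:Z + 1)); last lia.
rewrite pentN pentS; ring.
Qed.

Let AB n : A n.+1 1 = B n 1 + q ^ (n.*2%:Z + 2) * B n 2.
Proof.
rewrite /B /A /S doubleS sum_qbinS mulr_sumr -big_split; apply: eq_bigr => k _ /=.
rewrite mulrA mulrDl addrC; congr (_ * _ + _ * _).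
  rewrite -exprM expn_z -!expfzDr //; congr (q ^ _).
  by rewrite (_ : n.+1%:Z - k%:Z = n%:Z - k%:Z + 1) ?pentS; lia.
by rewrite /f (_ : n.+1%:Z - k.+1%:Z = n%:Z - k%:Z) //; lia.
Qed.

(** As [B n 2] vanishes and [A n 0 = A n 1], the recurrences multiply [A n 1] by 1 + q^(2n+1) at
    each step. *)
Let sum_even_prod n : A n 1 = \prod_(i < n) (1 + q ^+ i.*2.+1).
Proof.
elim: n => [|n IH].
  by rewrite big_ord0 /A /S big_ord1 qbin0 mulr1.
rewrite big_ord_recr AB B2 mulr0 addr0 BA (Asym n (1 - 1)) subrr subr0 IH /=.
rewrite mulrDr mulr1 [_ * q ^+ _]mulrC expn_z; congr (_ + q ^ _ * _); lia.
Qed.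

Lemma prod_odd_qbin n :
  \prod_(i < n) (1 + q ^+ i.*2.+1) * (1 + Q ^+ n.*2.+1) =
  \sum_(r < n.+1) q ^+ pentn r * (1 + q ^+ (4 * r + 2)) * qbin Q n.*2.+1 (n - r).
Proof.
have -> : \prod_(i < n) (1 + q ^+ i.*2.+1) * (1 + Q ^+ n.*2.+1) = B n 0.
  (* The vanishing of [B n 2] determines [A n 2], which equals [A n (-1)] by symmetry. *)
  have e2 : A n 2 = q ^ n.*2%:Z * A n 1.
    have := BA n 2; rewrite B2 addrK => /eqP.
    by rewrite eq_sym addr_eq0 oppr_pchar2 // => /eqP.
  rewrite BA (Asym n 0) (Asym n (0 - 1)) sub0r opprK subr0 e2 -sum_even_prod.
  rewrite mulrA -expfzDr // mulrDr mulr1 mulrC -exprM expn_z.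
  congr (_ + q ^ _ * _); lia.
(* Pair r >= 0 with -1-r; the exponents are [pentn r] and [pentn r + 4r + 2]. *)
rewrite /B /S -doubleS (sum_reflect _ (fun k => f n 0 k * qbin Q n.*2.+1 k)).
rewrite (reindex_inj rev_ord_inj); apply: eq_bigr => r _ /=.
have rn := ltn_ord r.
rewrite subSS qbin_sub; last lia.
rewrite -mulrDl; congr (_ * _).
rewrite mulrDr mulr1 -exprD !expn_z /f !mul0r !addr0; congr (q ^ _ + q ^ _).
  by rewrite -pent_nat; congr pent; lia.
rewrite (_ : n%:Z - (n.*2.+1 - (n - r))%N%:Z = - (r%:Z + 1)); last lia.
rewrite PoszD -pent_nat pentN pentS; lia.
Qed.

End FiniteIdentity.

(** * Congruences over ['F_2] modulo powers of ['X] *)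

Section Truncation.
Local Open Scope ring_scope.
Implicit Types p u v : {poly 'F_2}.

Lemma pchar_poly2 : 2 \in [pchar {poly 'F_2}].
Proof. by rewrite pchar_poly pchar_Fp. Qed.

(** Obtained in the fraction field, where ['X] is invertible and integer powers make sense. *)
Lemma prod_odd_qbin_poly n :
  \prod_(i < n) (1 + 'X^(i.*2.+1)) * (1 + 'X^2 ^+ n.*2.+1) =
  \sum_(r < n.+1) 'X^(pentn r) * (1 + 'X^(4 * r + 2)) *
    qbin 'X^2 n.*2.+1 (n - r) :> {poly 'F_2}.
Proof.
apply/eqP; rewrite -tofrac_eq; apply/eqP.
rewrite rmorphM rmorph_prod rmorph_sum /=.
under eq_bigr => i _ do rewrite rmorphD rmorph1 rmorphXn.
under [RHS]eq_bigr => i _ do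
  rewrite !rmorphM rmorph_qbin rmorphD rmorph1 !rmorphXn.
rewrite rmorphD rmorph1 !rmorphXn; apply: prod_odd_qbin.
  by rewrite tofrac_eq0 polyX_eq0.
exact: (rmorph_pchar (@tofrac {poly 'F_2}) pchar_poly2).
Qed.

Lemma dvdXn_coef N p i : 'X^N %| p -> (i < N)%N -> p`_i = 0.
Proof. by move=> /dvdpP[u ->] iN; rewrite coefMXn iN. Qed.

Lemma dvdp_prod1 p (I : Type) (s : seq I) (P : pred I) (F : I -> {poly 'F_2}) :
  (forall i, P i -> p %| F i - 1) -> p %| \prod_(i <- s | P i) F i - 1.
Proof.
move=> H; elim/big_rec: _ => [|i u Pi IH]; first by rewrite subrr dvdp0.
have -> : F i * u - 1 = F i * (u - 1) + (F i - 1) by ring.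
by rewrite dvdp_add ?H // dvdp_mull.
Qed.

Lemma dvdp_subM p u u' v v' :
  p %| u - u' -> p %| v - v' -> p %| u * v - u' * v'.
Proof.
move=> H H'; have -> : u * v - u' * v' = (u - u') * v + u' * (v - v') by ring.
by apply: dvdp_add; [exact: dvdp_mulr | exact: dvdp_mull].
Qed.

Local Notation P := (qpoch ('X^2 : {poly 'F_2})).

Lemma qpoch_cat a b c : (a <= b <= c)%N -> P a c = P a b * P b c.
Proof. by case/andP=> ab bc; rewrite /qpoch (big_cat_nat ab bc). Qed.

Lemma qpoch_trunc a b : (0 < a <= b)%N -> 'X^(2 * a) %| P 1 b - P 1 a.
Proof.
move=> /andP[a0 ab]; rewrite (@qpoch_cat 1 a b) ?a0 //.
rewrite -[X in _ - X]mulr1 -mulrBr dvdp_mull //.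
rewrite /qpoch big_nat_cond; apply: dvdp_prod1 => i /andP[/andP[ai _] _].
by rewrite addrC addKr dvdpNr -exprM dvdp_exp2l // leq_mul2l.
Qed.

(** The constant term is 1; this allows cancellation modulo ['X^N]. *)
Lemma coprime_qpoch N b : coprimep 'X^N (P 1 b).
Proof.
apply: coprimep_expl; rewrite /qpoch big_nat_cond.
elim/big_ind: _ => [|u v|i /andP[/andP[i0 _] _]]; first exact: coprimep1.
  by rewrite coprimepMr => -> ->.
rewrite -exprM coprimep_sym coprimepX rootE !hornerE.
by rewrite expr0n muln_eq0 /= eqn0Ngt i0 subr0 oner_eq0.
Qed.

(* Multiplied by q-Pochhammer symbols, which are invertible modulo powers of X,
   both sides become products congruent to (Q; Q)_d ^ 2. *)
Lemma durfee_trunc r k d :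
  'X^(2 * d.+1) %|
    qbin 'X^2 (k + d) k * P (k + r.*2.+2) (k + d + r.*2.+2)
    - qbin 'X^2 (r + k).*2.+1 k * P (r + k).*2.+2 (r + k + d).*2.+2.
Proof.
set a := _ * _; set b := _ * _.
set u := P 1 k.+1 * P 1 (k + r.*2.+2) * P 1 d.+1.
suff H : 'X^(2 * d.+1) %| u * (a - b).
  rewrite Gauss_dvdpr in H => //.
  by rewrite !coprimepMr !coprime_qpoch.
have e1 : u * a = P 1 (k + d).+1 * P 1 (k + d + r.*2.+2).
  rewrite -qbin_qpoch /u /a (@qpoch_cat 1 (k + r.*2.+2) (k + d + r.*2.+2)); last lia.
  by ring.
have e2 : u * b = P 1 (r + k + d).*2.+2 * P 1 d.+1.
  rewrite /u /b (@qpoch_cat 1 (r + k).*2.+2 (r + k + d).*2.+2); last lia.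
  have -> : (r + k).*2.+2 = (k + (k + r.*2.+1)).+1 by lia.
  rewrite -qbin_qpoch.
  have -> : (r + k).*2.+1 = (k + (k + r.*2.+1))%N by lia.
  rewrite addnS; ring.
rewrite mulrBr e1 e2 -[X in X - _](subrK (P 1 d.+1 * P 1 d.+1)) -addrA -mulrBl.
apply: dvdp_add; last by rewrite -opprB mulNr dvdpNr dvdp_mulr // qpoch_trunc //; lia.
by apply: dvdp_subM; apply: qpoch_trunc; lia.
Qed.

(** Termwise comparison with [qbin_durfee] at y = Q^(2r+1), multiplied by Q^(r(r+1)). *)
Lemma durfee_sum r K :
  'X^(2 * (r + K).+1) %|
    \sum_(k < K.+1) 'X^(2 * ((r + k) * (r + k).+1)) *
       (qbin 'X^2 (r + k).*2.+1 k * P (r + k).*2.+2 (r + K).*2.+2)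
    - 'X^(2 * (r * r.+1)).
Proof.
rewrite -[X in _ - X]mulr1 -(qbin_durfee ('X^2 : {poly 'F_2}) K ('X^2 ^+ r.*2.+1)).
rewrite mulr_sumr -sumrB; elim/big_ind: _ => [|u v|k _]; first exact: dvdp0.
  exact: dvdp_add.
have kK : (k <= K)%N by rewrite -ltnS.
have -> : \prod_(k.+1 <= i < K.+1) (1 - 'X^2 ^+ r.*2.+1 * 'X^2 ^+ i) =
          P (k + r.*2.+2) (k + (K - k) + r.*2.+2).
  have -> : (k + r.*2.+2 = k.+1 + r.*2.+1)%N by lia.
  rewrite /qpoch big_addn.
  have -> : (k + (K - k) + r.*2.+2 - r.*2.+1 = K.+1)%N by lia.
  by apply: eq_bigr => i _; rewrite -exprD addnC.
have := durfee_trunc r k (K - k).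
have -> : (r + k + (K - k) = r + K)%N by lia.
rewrite {1}subnKC // => /(dvdp_mul (dvdpp ('X^(2 * ((r + k) * (r + k).+1))))).
rewrite -exprD => H.
have -> : 'X^2 ^+ (k * k) * ('X^2 ^+ r.*2.+1) ^+ k =
          'X^(2 * (k * k + r.*2.+1 * k)) :> {poly 'F_2} by rewrite -!exprM -exprD; congr ('X^_); lia.
rewrite -!mulrA [X in _ - X]mulrA -exprD -mulnDr.
have -> : (r * r.+1 + (k * k + r.*2.+1 * k) = (r + k) * (r + k).+1)%N by lia.
(* The error is small enough because (r+k)(r+k+1) + (K-k+1) >= r+K+1. *)
rewrite -mulrBr -opprB mulrN dvdpNr; apply: dvdp_trans H; apply: dvdp_exp2l; nia.
Qed.

(** In summand j, the monomial comes from 2, 4, ..., 2j each taken twice, the first product from the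
    odd parts, the second from the even parts between 4j+2 and 4L+2. *)
Definition c4_gf (L : nat) : {poly 'F_2} :=
  \sum_(j < L.+1) 'X^(2 * (j * j.+1)) *
    (\prod_(i < j) (1 + 'X^(i.*2.+1)) *
     \prod_(j.*2.+1 <= i < L.*2.+2) (1 + 'X^2 ^+ i)).

(** Expand the odd product, exchange the sums over j and r, and evaluate the inner sum by
    [durfee_sum] with k = j-r. *)
Lemma c4_gf_trunc L :
  'X^(2 * L.+1) %| c4_gf L -
    \sum_(r < L.+1) 'X^(pentn r) * (1 + 'X^(4 * r + 2)) * 'X^(2 * (r * r.+1)).
Proof.
pose F (r j : nat) : {poly 'F_2} := 'X^(2 * (j * j.+1)) *
  (qbin 'X^2 j.*2.+1 (j - r) * P j.*2.+2 L.*2.+2).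
have -> : c4_gf L = \sum_(r < L.+1) 'X^(pentn r) * (1 + 'X^(4 * r + 2)) *
   \sum_(r <= j < L.+1) F r j.
  under [RHS]eq_bigr => r _ do
    rewrite (big_nat_widenl r 0) // big_mkord mulr_sumr.
  rewrite (exchange_big_dep xpredT) //=; apply: eq_bigr => j _.
  have jL := ltn_ord j.
  (* The factor i = 2j+1 is split off because the finite identity contains 1 + Q^(2j+1). *)
  rewrite big_ltn; last lia.
  rewrite mulrA mulrA -[X in X * _]mulrA prod_odd_qbin_poly.
  have -> : \prod_(j.*2.+2 <= i < L.*2.+2) (1 + 'X^2 ^+ i) = P j.*2.+2 L.*2.+2.
    by apply: eq_bigr => i _; rewrite oppr_pchar2 ?pchar_poly2.
  rewrite (big_ord_widen L.+1 (fun r => 'X^(pentn r) * (1 + 'X^(4 * r + 2)) *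
    qbin 'X^2 j.*2.+1 (j - r))) // mulr_sumr mulr_suml.
  by apply: eq_bigr => r _; rewrite /F; ring.
rewrite -sumrB; elim/big_ind: _ => [|u v|r _]; first exact: dvdp0.
  exact: dvdp_add.
rewrite -mulrBr dvdp_mull //; have rL := ltn_ord r.
have := durfee_sum r (L - r); rewrite subnKC //.
congr (_ %| _ - _); rewrite -[RHS]/(\sum_(0 + r <= j < L.+1) F r j).
rewrite big_addn big_mkord subSn //.
by apply: eq_bigr => k _; rewrite /F [(k + r)%N]addnC addKn.
Qed.






End Truncation.

(** * Exponents of the resulting theta series *)

Section Exponents.
Local Open Scope ring_scope.

(** [a r] and [a r + 4r + 2] are the values of (7j^2+3j)/2 at j = r and j = -(r+1). *)
Let a (r : nat) : nat := (pentn r + 2 * (r * r.+1))%N.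

Let aE r : (2 * a r = 7 * (r * r) + 3 * r)%N.
Proof. by have := pentE r; rewrite pent_nat /a; lia. Qed.

(** Both exponents of s lie below those of r, so at most one monomial reaches a given degree. *)
Let a_gap s r : (s < r)%N -> (a s + (4 * s + 2) < a r)%N.
Proof. by move=> sr; have := aE s; have := aE r; have := leq_mul sr sr; lia. Qed.

Lemma coef_theta n :
  (\sum_(r < n.+1) 'X^(pentn r) * (1 + 'X^(4 * r + 2)) * 'X^(2 * (r * r.+1))
     : {poly 'F_2})`_n != 0 <->
  exists j : int, 2 * n%:Z = 7 * j ^+ 2 + 3 * j.
Proof.
have coefE (r : nat) :
  ('X^(pentn r) * (1 + 'X^(4 * r + 2)) * 'X^(2 * (r * r.+1)) : {poly 'F_2})`_n =
  (n == a r)%:R + (n == a r + (4 * r + 2))%N%:R.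
  rewrite mulrAC -exprD -/(a r) mulrDr mulr1 -exprD coefD !coefXn //.
rewrite coef_sum; under eq_bigr => r _ do rewrite coefE.
split=> [nz|[j ej]].
  have [r /orP[]/eqP e|no] :=
    pickP (fun r : 'I_n.+1 => (n == a r) || (n == a r + (4 * r + 2))%N).
  - by exists r%:Z; have := aE r; lia.
  - by exists (- (r%:Z + 1)); have := aE r; lia.
  - case/eqP: nz; apply: big1 => r _.
    by have /negbT := no r; rewrite negb_or => /andP[/negbTE-> /negbTE->]; rewrite addr0.
have [r er] : exists r : nat, n = a r \/ n = (a r + (4 * r + 2))%N.
  case: j ej => r ej; exists r; have := aE r.
    by left; lia.
  by rewrite NegzE in ej; right; lia.
have rn : (r < n.+1)%N by case: er; rewrite /a /pentn; lia.
rewrite (bigD1 (Ordinal rn)) //= big1 => [|s sr].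
  have [e1 e2] : (a r == a r + (4 * r + 2))%N = false /\
                 (a r + (4 * r + 2) == a r)%N = false by lia.
  by case: er => ->; rewrite eqxx ?e1 ?e2 !(addr0, add0r) oner_eq0.
have {}sr : nat_of_ord s <> r by move=> e; case/eqP: sr; apply: val_inj.
have [e1 e2] : (n == a s) = false /\ (n == a s + (4 * s + 2))%N = false.
  have [/a_gap lt|/a_gap lt] : (s < r \/ r < s)%N by lia.
  - by split; apply/eqP => e; lia.
  - by split; apply/eqP => e; lia.
by rewrite e1 e2 addr0.
Qed.

End Exponents.

(** * The partition conditions in terms of multiplicities *)

(* Condition (b) read off part by part; [j = 0] gives condition (a). *)
Definition allowed (j k m : nat) : bool :=
  if k == 0 then m == 0
  else if odd k then (if k < 2 * j then m < 2 else m < 1)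
  else if k <= 2 * j then m == 2
  else if 4 * j + 2 <= k then m < 2 else m < 1.

Lemma cond_allowed (m : nat -> nat) : m 0 = 0 ->
  (cond_a m \/ cond_b m) <-> exists j, forall k, allowed j k (m k).
Proof.
move=> m0; split=> [[H|[j [j1 [H1 [H2 H3]]]]]|[j H]].
- exists 0 => k; have := H k; rewrite /allowed.
  by do ?case: ifP; case: eqP => [->|] //; lia.
- exists j => k; rewrite /allowed; case: eqP => [->|k0]; first by rewrite m0.
  case: ifP => ok; first by have := H3 k ok; case: ifP; lia.
  case: ifP => kj; last by have := H2 k; rewrite ok; case: ifP; lia.
  by have := H1 k./2 ltac:(lia); rewrite (_ : 2 * k./2 = k) => [->|]; lia.
- case: (posnP j) => j0.
    by left=> k k0 mk; have := H k; rewrite /allowed j0; do ?case: ifP; lia.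
  right; exists j; split=> //; split; [|split].
  + by move=> i ij; have := H (2 * i); rewrite /allowed; do ?case: ifP; lia.
  + by move=> k k0 ok kj mk; have := H k; rewrite /allowed; do ?case: ifP; lia.
  + by move=> k ok mk; have := H k; rewrite /allowed; do ?case: ifP; lia.
Qed.

(* If i < j, the part 2(i+1) is excluded for i but occurs twice for j. *)
Lemma allowed_inj (m : nat -> nat) i j :
  (forall k, allowed i k (m k)) -> (forall k, allowed j k (m k)) -> i = j.
Proof.
wlog ij : i j / i < j => [hw Hi Hj|Hi Hj].
  by case: (ltngtP i j) => // ?; [apply: hw | apply/esym; apply: hw].
have := Hi (2 * i.+1); have := Hj (2 * i.+1); rewrite /allowed.
by do ?case: ifP; lia.
Qed.

Lemma mult_of_ord n (f : {ffun 'I_n.+1 -> 'I_n.+1}) (k : 'I_n.+1) :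
  mult_of f k = f k.
Proof. by rewrite /mult_of valK. Qed.

Lemma mult_of_large n (f : {ffun 'I_n.+1 -> 'I_n.+1}) k :
  n < k -> mult_of f k = 0.
Proof. by move=> nk; rewrite /mult_of insubF // ltnNge nk. Qed.

(** A part 2j > 0 occurring twice is at most n; conversely 2j <= n makes multiplicity 0 admissible
    for all k > n. *)
Lemma allowed_mult n (f : {ffun 'I_n.+1 -> 'I_n.+1}) j :
  (forall k, allowed j k (mult_of f k)) <->
  (2 * j <= n) /\ (forall k : 'I_n.+1, allowed j k (f k)).
Proof.
split=> [H|[jn H] k].
  split=> [|k]; last by rewrite -mult_of_ord.
  rewrite leqNgt; apply/negP => nj; have := H (2 * j).
  by rewrite mult_of_large // /allowed; do ?case: ifP; lia.
case: (ltnP n k) => [nk|kn].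
  by rewrite mult_of_large // /allowed; do ?case: ifP; lia.
by have := H (Ordinal (kn : k < n.+1)); rewrite -mult_of_ord.
Qed.

(** * Counting partitions as a coefficient of a product *)

Section Counting.
Local Open Scope ring_scope.
Variable n : nat.

Let good (j : nat) (f : {ffun 'I_n.+1 -> 'I_n.+1}) : bool :=
  (\sum_(k < n.+1) (k * f k) == n)%N && [forall k : 'I_n.+1, allowed j k (f k)].

(** By uniqueness of j, the indicator of the defining condition is the sum over j of the indicators
    [good j f]. *)
Lemma c4_sum (R : pzSemiRingType) :
  (c4 n)%:R = \sum_(j < n.+1 | (2 * j <= n)%N) \sum_f (good j f)%:R :> R.
Proof.
rewrite exchange_big /c4 cardsE -sum1_card natr_sum big_mkcond /=.
apply: eq_bigr => f _; rewrite unfold_in.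
case: asboolP => [[[f0 fn]]|H].
  rewrite cond_allowed // => -[j Hj]; have [jn Hj'] := (allowed_mult f j).1 Hj.
  have jn' : (j < n.+1)%N by lia.
  rewrite (bigD1 (Ordinal jn')) //= big1 => [|i /andP[ine ij]].
    by rewrite /good fn eqxx addr0 (introT forallP).
  case: (boolP (good i f)) => // /andP[_ /forallP Hi].
  case/eqP: ij; apply: val_inj; apply: (@allowed_inj (mult_of f)) => //.
  by apply/allowed_mult.
rewrite big1 // => j jn; case: (boolP (good j f)) => // /andP[/eqP fn /forallP Hj].
case: H; have f0 : mult_of f 0 = 0%N.
  by have := Hj ord0; rewrite -mult_of_ord => /eqP.
by split=> //; apply/cond_allowed => //; exists j; apply/allowed_mult.
Qed.

(* The generating function of the allowed multiplicities of the part k. *)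
Definition factor (j k : nat) : {poly 'F_2} :=
  if k == 0%N then 1
  else if odd k then (if (k < 2 * j)%N then 1 + 'X^k else 1)
  else if (k <= 2 * j)%N then 'X^(2 * k)
  else if (4 * j + 2 <= k)%N then 1 + 'X^k else 1.

Lemma sum_allowed j (k : 'I_n.+1) : (2 * j <= n)%N ->
  \sum_(m < n.+1 | allowed j k m) 'X^(k * m) = factor j k.
Proof.
move=> jn; have kn := ltn_ord k; rewrite /allowed /factor.
have sum1 : \sum_(m < n.+1 | (m < 1)%N) 'X^(k * m) = 1 :> {poly 'F_2}.
  by rewrite -(big_ord_widen _ (fun m => 'X^(k * m))) // big_ord1 muln0.
have sum2 : (0 < k)%N -> \sum_(m < n.+1 | (m < 2)%N) 'X^(k * m) = 1 + 'X^k :> {poly 'F_2}.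
  move=> k0; rewrite -(big_ord_widen _ (fun m => 'X^(k * m))); last lia.
  by rewrite big_ord_recl big_ord1 muln0 muln1.
case: eqP => [k0|/eqP]; last rewrite -lt0n => k0.
  by rewrite -[RHS]sum1; apply: eq_bigl => m; lia.
case: ifP => ok; first by case: ifP => _; [exact: sum2 | exact: sum1].
case: leqP => kj; last by case: ifP => _; [exact: sum2 | exact: sum1].
(* Here k is even and positive with k <= 2j <= n, so multiplicity 2 is in range. *)
have n2 : (2 < n.+1)%N by lia.
by rewrite (big_pred1 (Ordinal n2)) //= mulnC.
Qed.

Lemma count_coef j : (2 * j <= n)%N ->
  \sum_f (good j f)%:R = (\prod_(k < n.+1) factor j k)`_n.
Proof.
move=> jn; have -> : \prod_(k < n.+1) factor j k =
    \prod_(k < n.+1) \sum_(m < n.+1 | allowed j k m) 'X^(k * m).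
  by apply: eq_bigr => k _; rewrite sum_allowed.
(* Distributing gives one monomial for each choice of multiplicities. *)
rewrite bigA_distr_big_dep /= coef_sum [RHS]big_mkcond; apply: eq_bigr => f _ /=.
rewrite -(big_morph _ (fun a b => exprD 'X a b) (expr0 _)) coefXn.
rewrite /good eq_sym; case: familyP => [H|H].
  rewrite (introT forallP) ?andbT //.
by case: forallP => // H'; rewrite andbF.
Qed.

End Counting.

(** * Identification of the products with [c4_gf] *)

Section Products.
Local Open Scope ring_scope.

Lemma prod_parity (R : comPzSemiRingType) M (F : nat -> R) :
  \prod_(k < M.*2) F k = \prod_(i < M) F i.*2 * \prod_(i < M) F i.*2.+1.
Proof.
elim: M => [|M IH]; first by rewrite !big_ord0 mulr1.
by rewrite doubleS !big_ord_recr IH /= -!mulrA; congr (_ * _); rewrite mulrCA.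
Qed.

Lemma prod_factor j L : (2 * j <= L)%N ->
  \prod_(k < L.*2.+2.*2) factor j k =
  'X^(2 * (j * j.+1)) * (\prod_(i < j) (1 + 'X^(i.*2.+1)) *
     \prod_(j.*2.+1 <= i < L.*2.+2) (1 + 'X^2 ^+ i)).
Proof.
move=> jL; rewrite prod_parity.
have -> : \prod_(i < L.*2.+2) factor j i.*2.+1 = \prod_(i < j) (1 + 'X^(i.*2.+1)).
  rewrite (big_ord_widen L.*2.+2 (fun i => 1 + 'X^(i.*2.+1))); last lia.
  rewrite [RHS]big_mkcond; apply: eq_bigr => i _.
  by rewrite /factor /= odd_double /= mul2n ltn_Sdouble.
rewrite [X in _ = _ * X]mulrC mulrA; congr (_ * _).
rewrite -(big_mkord xpredT (fun i => factor j i.*2)).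
(* Even parts 2i: doubled for 1 <= i <= j, absent for j < i <= 2j, optional from 2j+1 on. *)
rewrite (big_cat_nat (n := j.*2.+1)) //=; last lia.
congr (_ * _); last first.
  apply: eq_big_nat => i /andP[ji _].
  rewrite /factor odd_double -exprM -mul2n.
  by do ?case: ifP => //; lia.
rewrite big_ltn // {1}/factor mul1r (big_cat_nat (n := j.+1)) //=; last lia.
rewrite [X in _ * X]big_nat_cond [X in _ * X]big1 => [|i /andP[ij _]].
  rewrite mulr1; suff H i : (i <= j)%N ->
      \prod_(1 <= k < i.+1) factor j k.*2 = 'X^(2 * (i * i.+1)) by exact: H.
  elim: i => [|i IH] ij; first by rewrite big_geq.
  rewrite big_nat_recr //= IH 1?ltnW // /factor odd_double /=.
  rewrite (_ : i.+1.*2 <= 2 * j)%N; last lia.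
  by rewrite -exprD; congr 'X^_; lia.
by rewrite /factor odd_double; do ?case: ifP => //; lia.
Qed.

(** Parts above n contribute 1 or 1 + X^k; as 2j <= n, none of them is doubled. *)
Lemma factor_trunc n N j : (2 * j <= n)%N -> (n <= N)%N ->
  'X^(n.+1) %| \prod_(k < N.+1) factor j k - \prod_(k < n.+1) factor j k.
Proof.
move=> jn nN; rewrite -!(big_mkord xpredT (factor j)).
rewrite (big_cat_nat (n := n.+1) (p := N.+1)) //=.
rewrite -[X in _ - X]mulr1 -mulrBr dvdp_mull // big_nat_cond.
apply: dvdp_prod1 => k /andP[/andP[nk _] _].
rewrite /factor; case: eqP => [|_]; first lia.
have d1 : 'X^(n.+1) %| (1 : {poly 'F_2}) - 1 by rewrite subrr dvdp0.
have d2 : 'X^(n.+1) %| (1 : {poly 'F_2}) + 'X^k - 1 by rewrite addrC addKr dvdp_exp2l.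
by case: odd; case: ifP => // H; [lia | case: ifP].
Qed.

Lemma c4_coef n : (c4 n)%:R = (c4_gf n)`_n.
Proof.
rewrite c4_sum coef_sum big_mkcond; apply: eq_bigr => j _.
(* If 2j > n, the monomial of degree 2j(j+1) already exceeds degree n. *)
case: leqP => jn; last by rewrite coefXnM; case: ltnP => //; nia.
rewrite count_coef // -prod_factor //.
(* The bound 4n+3 is the largest part covered by [prod_factor] at L = n. *)
have := @factor_trunc n n.*2.+2.*2.-1 j jn ltac:(lia).
move=> /dvdXn_coef/(_ (leqnn _))/eqP; rewrite coefB subr_eq0 => /eqP.
by rewrite prednK.
Qed.

End Products.

(** * Parity of [c4 n] as a coefficient in ['F_2] *)

Theorem theorem5 (n : nat) :
  odd (c4 n) <->
  (exists j : int, (2 * n%:Z = 7 * j ^+ 2 + 3 * j)%R).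
Proof.
rewrite -coef_theta.
have -> : odd (c4 n) = ((c4 n)%:R != 0 :> 'F_2)%R.
  by rewrite -(dvdn_pcharf (pchar_Fp (isT : prime 2))) dvdn2 negbK.
rewrite c4_coef; have := dvdXn_coef (c4_gf_trunc n) (ltac:(lia) : n < 2 * n.+1).
by move=> /eqP; rewrite coefB subr_eq0 => /eqP->.
Qed.
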